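(* Fix $I,J\in\mathbb S$ with $J\perp I$. Let $f,\psi\in\mathcal{SR}(\mathbb H)$ with splittings $f_I=F+GJ$, $\psi_I=P+QJ$, where $F,G,P,Q:\mathbb C_I\to\mathbb C_I$ are entire, and set $$\Psi:=\Phi_I(\psi)=\begin{pmatrix}P&Q\\-Q^\#&P^\#\end{pmatrix}.$$ Then on $\mathbb C_I$ one has $(f\bullet\psi)_I=\bigl(\Phi_I(f\bullet\psi)\bigr)_{11}+\bigl(\Phi_I(f\bullet\psi)\bigr)_{12}J$, where $$\bigl(\Phi_I(f\bullet\psi)\bigr)_{11}=\bigl(F(\Psi)\bigr)_{11}-\bigl(G^\#(\Psi)\bigr)_{12},\qquad \bigl(\Phi_I(f\bullet\psi)\bigr)_{12}=\bigl(F^\#(\Psi)\bigr)_{12}+\bigl(G(\Psi)\bigr)_{11}.$$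
   Context: $\mathbb H$ denotes the quaternions, $\mathbb S=\{I\in\mathbb H: I^2=-1\}$, and for $I\in\mathbb S$, $\mathbb C_I=\{x+yI: x,y\in\mathbb R\}$. $J\perp I$ means orthogonality of imaginary units (so $IJ=-JI$). A real differentiable $f:\mathbb H\to\mathbb H$ is slice regular if for every $I\in\mathbb S$ the restriction $f_I:=f|_{\mathbb C_I}$ satisfies $\frac12(\partial_x+I\partial_y)f_I(x+yI)=0$; $\mathcal{SR}(\mathbb H)$ is the class of such functions. For $J\perp I$, each $f\in\mathcal{SR}(\mathbb H)$ splits uniquely as $f_I=F+GJ$ with $F,G:\mathbb C_I\to\mathbb C_I$ entire, and $\Phi_I(f):=\begin{pmatrix}F&G\\-G^\#&F^\#\end{pmatrix}$, where $D^\#(z)=\overline{D(\overline z)}$. Every $f\in\mathcal{SR}(\mathbb H)$ has a power series $f(\xi)=\sum_{n\ge0}\xi^na_n$, $a_n\in\mathbb H$; for $f=\sum\xi^na_n$, $g=\sum\xi^nb_n$ the $\star$-product is $(f\star g)(\xi)=\sum_n\xi^n\sum_{k=0}^na_kb_{n-k}$. The slice regular composition is $(f\bullet\psi)(\xi)=\sum_{n\ge0}\psi^{\star n}(\xi)a_n$, where $\psi^{\star n}$ is the $n$-th $\star$-power and $\psi^{\star0}\equiv1$. For an entire function $\varphi(\xi)=\sum_{n\ge0}\xi^nc_n$ with $c_n\in\mathbb C_I$, $\varphi(\Psi):=\sum_{n\ge0}\Psi^nc_n$ (pointwise on $\mathbb C_I$; the usual holomorphic functional calculus for $2\times2$ matrices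 over $\mathbb C_I$). $\Theta_{ij}$ denotes the $(i,j)$-entry of a matrix $\Theta$. *)

(* Defs.v *)
From HB Require Import structures.
From mathcomp Require Import all_boot all_order all_algebra.
From mathcomp Require Import all_classical all_reals all_analysis.
From mathcomp Require Import ring lra.
Set Implicit Arguments.
Unset Strict Implicit.
Unset Printing Implicit Defensive.
Import Order.TTheory GRing.Theory Num.Theory.
Import numFieldNormedType.Exports.
Local Open Scope classical_set_scope.
Local Open Scope ring_scope.

(* The quaternion q0 + q1 i + q2 j + q3 k is the row (q0, q1, q2, q3); the
   topology is the product one and the product is Hamilton's. *)
Definition quat (R : realType) : Type := 'rV[R]_4.

HB.instance Definition _ (R : realType) := NormedModule.on (quat R).
HB.instance Definition _ (R : realType) := Complete.on (quat R).

Definition mkquat (R : realType) (a b c d : R) : quat R :=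
  \row_(k < 4) [:: a; b; c; d]`_k.

Definition q0 (R : realType) (q : quat R) : R := q ord0 (inord 0).
Definition q1 (R : realType) (q : quat R) : R := q ord0 (inord 1).
Definition q2 (R : realType) (q : quat R) : R := q ord0 (inord 2).
Definition q3 (R : realType) (q : quat R) : R := q ord0 (inord 3).

Definition quat_mul (R : realType) (p q : quat R) : quat R :=
  mkquat (q0 p * q0 q - q1 p * q1 q - q2 p * q2 q - q3 p * q3 q)
      (q0 p * q1 q + q1 p * q0 q + q2 p * q3 q - q3 p * q2 q)
      (q0 p * q2 q - q1 p * q3 q + q2 p * q0 q + q3 p * q1 q)
      (q0 p * q3 q + q1 p * q2 q - q2 p * q1 q + q3 p * q0 q).

Section QuatAlgebra.
Variable R : realType.
Implicit Types p q r : quat R.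

Lemma mkquatE (a b c d : R) :
  [/\ q0 (mkquat a b c d) = a, q1 (mkquat a b c d) = b,
      q2 (mkquat a b c d) = c & q3 (mkquat a b c d) = d].
Proof. by split; rewrite /q0 /q1 /q2 /q3 /mkquat mxE inordK. Qed.

Definition q0E a b c d : q0 (mkquat a b c d) = a := let: And4 h _ _ _ := mkquatE a b c d in h.
Definition q1E a b c d : q1 (mkquat a b c d) = b := let: And4 _ h _ _ := mkquatE a b c d in h.
Definition q2E a b c d : q2 (mkquat a b c d) = c := let: And4 _ _ h _ := mkquatE a b c d in h.
Definition q3E a b c d : q3 (mkquat a b c d) = d := let: And4 _ _ _ h := mkquatE a b c d in h.

Lemma eq_quat p q :
  q0 p = q0 q -> q1 p = q1 q -> q2 p = q2 q -> q3 p = q3 q -> p = q.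
Proof.
move=> h0 h1 h2 h3; apply/rowP => k; rewrite -(inord_val k).
by case: k => -[|[|[|[|//]]]] ?; [exact: h0|exact: h1|exact: h2|exact: h3].
Qed.

Lemma quatD p q : [/\ q0 (p + q) = q0 p + q0 q, q1 (p + q) = q1 p + q1 q,
  q2 (p + q) = q2 p + q2 q & q3 (p + q) = q3 p + q3 q].
Proof. by split; rewrite /q0 /q1 /q2 /q3 mxE. Qed.

Lemma quatZ (a : R) p : [/\ q0 (a *: p) = a * q0 p, q1 (a *: p) = a * q1 p,
  q2 (a *: p) = a * q2 p & q3 (a *: p) = a * q3 p].
Proof. by split; rewrite /q0 /q1 /q2 /q3 mxE. Qed.

Lemma q0D p q : q0 (p + q) = q0 p + q0 q. Proof. by case: (quatD p q). Qed.
Lemma q1D p q : q1 (p + q) = q1 p + q1 q. Proof. by case: (quatD p q). Qed.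
Lemma q2D p q : q2 (p + q) = q2 p + q2 q. Proof. by case: (quatD p q). Qed.
Lemma q3D p q : q3 (p + q) = q3 p + q3 q. Proof. by case: (quatD p q). Qed.
Lemma q0Z a p : q0 (a *: p) = a * q0 p. Proof. by case: (quatZ a p). Qed.
Lemma q1Z a p : q1 (a *: p) = a * q1 p. Proof. by case: (quatZ a p). Qed.
Lemma q2Z a p : q2 (a *: p) = a * q2 p. Proof. by case: (quatZ a p). Qed.
Lemma q3Z a p : q3 (a *: p) = a * q3 p. Proof. by case: (quatZ a p). Qed.
Let qE := (q0E, q1E, q2E, q3E, q0D, q1D, q2D, q3D, q0Z, q1Z, q2Z, q3Z).

Lemma quat_mulA : associative (@quat_mul R).
Proof. by move=> p q r; apply: eq_quat; rewrite /quat_mul !qE; ring. Qed.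

Lemma quat_mul1l : left_id (mkquat 1 0 0 0) (@quat_mul R).
Proof. by move=> p; apply: eq_quat; rewrite /quat_mul !qE; ring. Qed.

Lemma quat_mul1r : right_id (mkquat 1 0 0 0) (@quat_mul R).
Proof. by move=> p; apply: eq_quat; rewrite /quat_mul !qE; ring. Qed.

Lemma quat_mulDl : left_distributive (@quat_mul R) +%R.
Proof. by move=> p q r; apply: eq_quat; rewrite /quat_mul !qE; ring. Qed.

Lemma quat_mulDr : right_distributive (@quat_mul R) +%R.
Proof. by move=> p q r; apply: eq_quat; rewrite /quat_mul !qE; ring. Qed.

Lemma quat_one_neq0 : mkquat (1 : R) 0 0 0 != 0 :> quat R.
Proof.
apply/eqP => /(congr1 (@q0 R)); rewrite q0E /q0 mxE => /eqP.
by rewrite oner_eq0.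
Qed.

HB.instance Definition _ := GRing.Zmodule_isNzRing.Build (quat R)
  quat_mulA quat_mul1l quat_mul1r quat_mulDl quat_mulDr quat_one_neq0.

Lemma quat_scaleAl (a : R) p q : a *: (p * q) = a *: p * q.
Proof.
by apply: eq_quat; rewrite /GRing.mul/= /quat_mul !qE; ring.
Qed.

HB.instance Definition _ := GRing.Lmodule_isLalgebra.Build R (quat R) quat_scaleAl.

Lemma quat_scaleAr (a : R) p q : a *: (p * q) = p * (a *: q).
Proof. by apply: eq_quat; rewrite /GRing.mul/= /quat_mul !qE; ring. Qed.

HB.instance Definition _ := GRing.Lalgebra_isAlgebra.Build R (quat R) quat_scaleAr.

End QuatAlgebra.

Section SliceRegular.
Variable R : realType.
Local Notation H := (quat R).
Implicit Types (I J q z xi : H) (f g h psi phi F G : H -> H).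

Definition imag_unit : set H := [set I | I * I = -1].

Definition slice I : set H :=
  [set z | exists x y : R, z = x%:A + y *: I].

Definition perp I J : Prop :=
  q0 I * q0 J + q1 I * q1 J + q2 I * q2 J + q3 I * q3 J = 0.

Definition quat_conj q : H := mkquat (q0 q) (- q1 q) (- q2 q) (- q3 q).

Definition slice_regular f : Prop :=
  (forall q, differentiable f q) /\
  (forall I, imag_unit I -> forall x y : R,
     2^-1 *: (derive1 (fun t : R => f (t%:A + y *: I)) x
              + I * derive1 (fun t : R => f (x%:A + t *: I)) y) = 0).

(* phi : C_I -> C_I is the sum of an everywhere convergent power series with
   coefficients in C_I; its values outside C_I are irrelevant. *)
Definition entire I phi : Prop :=
  (forall z, slice I z -> slice I (phi z)) /\
  (exists2 c : nat -> H, forall n, slice I (c n) &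
     forall z, slice I z -> series (fun n => z ^+ n * c n) @ \oo --> phi z).

Definition splits I J f F G : Prop :=
  forall z, slice I z -> f z = F z + G z * J.

Definition sharp F : H -> H := fun z => quat_conj (F (quat_conj z)).

Definition splitmx F G z : 'M[H]_2 :=
  \matrix_(i, j) if i == 0 then (if j == 0 then F z else G z)
                 else (if j == 0 then - sharp G z else sharp F z).

(* The components u, v in C_I of q = u + v J: since I commutes with C_I and
   anticommutes with J, one has I q I = - u + v J.  See quat_splitP below. *)
Definition split_fst I q : H := 2^-1 *: (q - I * q * I).
Definition split_snd I J q : H := - (2^-1 *: (q + I * q * I)) * J.

Definition Phi I J h : H -> 'M[H]_2 :=
  splitmx (split_fst I \o h) (split_snd I J \o h).

(* The coefficients of the expansion f(xi) = \sum_n xi^n a_n, read off from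
   the restriction of f to the real axis: a_n = f^(n)(0) / n!.
   See qcoefE below. *)
Definition qcoef f (n : nat) : H :=
  n`!%:R^-1 *: derive1n n (fun x : R => f x%:A) 0.

Definition star_series f g xi : nat -> H :=
  series (fun n => xi ^+ n * \sum_(k < n.+1) qcoef f k * qcoef g (n - k)).

Definition star f g : H -> H := fun xi => limn (star_series f g xi).

Definition starpow psi (n : nat) : H -> H := iter n (star psi) (fun=> 1).

Definition scomp_series f psi xi : nat -> H :=
  series (fun n => starpow psi n xi * qcoef f n).

Definition scomp f psi : H -> H := fun xi => limn (scomp_series f psi xi).

Definition mxfun_series phi (M : 'M[H]_2) : nat -> 'M[H]_2 :=
  series (fun n => M ^+ n *m (qcoef phi n)%:M).

Definition mxfun phi (M : 'M[H]_2) : 'M[H]_2 := limn (mxfun_series phi M).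

End SliceRegular.

Section Splitting.
Variable R : realType.
Implicit Types (I J p q u v z : quat R) (f F G : quat R -> quat R).

Let mulqE p q : p * q = quat_mul p q. Proof. by []. Qed.
Let oneqE : (1 : quat R) = mkquat 1 0 0 0. Proof. by []. Qed.
Let q0N p : q0 (- p) = - q0 p. Proof. by rewrite -scaleN1r q0Z mulN1r. Qed.
Let q1N p : q1 (- p) = - q1 p. Proof. by rewrite -scaleN1r q1Z mulN1r. Qed.
Let q2N p : q2 (- p) = - q2 p. Proof. by rewrite -scaleN1r q2Z mulN1r. Qed.
Let q3N p : q3 (- p) = - q3 p. Proof. by rewrite -scaleN1r q3Z mulN1r. Qed.
Let qE := (q0E, q1E, q2E, q3E, q0D, q1D, q2D, q3D, q0Z, q1Z, q2Z, q3Z,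
  q0N, q1N, q2N, q3N).

Lemma imag_unitP I : imag_unit I <->
  q0 I = 0 /\ q1 I ^+ 2 + q2 I ^+ 2 + q3 I ^+ 2 = 1.
Proof.
rewrite /imag_unit/=; split=> [h|[h0 h1]]; last first.
  apply: eq_quat; rewrite mulqE /quat_mul oneqE !qE h0.
  - by rewrite -h1; ring.
  - ring.
  - ring.
  - ring.
have e0 : q0 (I * I) = q0 (-1) by rewrite h.
have e1 : q1 (I * I) = q1 (-1) by rewrite h.
have e2 : q2 (I * I) = q2 (-1) by rewrite h.
have e3 : q3 (I * I) = q3 (-1) by rewrite h.
move: e0 e1 e2 e3; rewrite mulqE /quat_mul oneqE !qE => e0 e1 e2 e3.
have [z0|n0] := eqVneq (q0 I) 0; first by split=> //; rewrite z0 in e0; lra.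
exfalso.
have z1 : q1 I = 0 by apply: (mulfI n0); lra.
have z2 : q2 I = 0 by apply: (mulfI n0); lra.
have z3 : q3 I = 0 by apply: (mulfI n0); lra.
by rewrite z1 z2 z3 in e0; have := sqr_ge0 (q0 I); lra.
Qed.

Lemma imag_unit_anticomm I J :
  imag_unit I -> imag_unit J -> perp I J -> J * I = - (I * J).
Proof.
move=> /imag_unitP[i0 _] /imag_unitP[j0 _]; rewrite /perp i0 j0 => h.
by apply: eq_quat; rewrite !mulqE /quat_mul !qE i0 j0; lra.
Qed.

Lemma slice_comm I u : slice I u -> I * u = u * I.
Proof.
move=> [x [y ->]].
by rewrite mulrDl mulrDr -!scalerAl -!scalerAr mul1r mulr1.
Qed.

Lemma comm_slice I u : imag_unit I -> I * u = u * I -> slice I u.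
Proof.
move=> /imag_unitP[i0 hn] h.
have e1 : q1 (I * u) = q1 (u * I) by rewrite h.
have e2 : q2 (I * u) = q2 (u * I) by rewrite h.
have e3 : q3 (I * u) = q3 (u * I) by rewrite h.
move: e1 e2 e3; rewrite !mulqE /quat_mul !qE i0 => e1 e2 e3.
have c1 : q2 I * q3 u = q3 I * q2 u by lra.
have c2 : q3 I * q1 u = q1 I * q3 u by lra.
have c3 : q1 I * q2 u = q2 I * q1 u by lra.
exists (q0 u), (q1 u * q1 I + q2 u * q2 I + q3 u * q3 I).
apply: eq_quat; rewrite oneqE !qE.
- by rewrite i0; ring.
- have d2 : q2 I * (q1 I * q2 u) = q2 I * (q2 I * q1 u) by rewrite c3.
  have d3 : q3 I * (q3 I * q1 u) = q3 I * (q1 I * q3 u) by rewrite c2.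
  have : q1 u * (q1 I ^+ 2 + q2 I ^+ 2 + q3 I ^+ 2) = q1 u by rewrite hn mulr1.
  lra.
- have d1 : q1 I * (q1 I * q2 u) = q1 I * (q2 I * q1 u) by rewrite c3.
  have d3 : q3 I * (q2 I * q3 u) = q3 I * (q3 I * q2 u) by rewrite c1.
  have : q2 u * (q1 I ^+ 2 + q2 I ^+ 2 + q3 I ^+ 2) = q2 u by rewrite hn mulr1.
  lra.
- have d1 : q1 I * (q3 I * q1 u) = q1 I * (q1 I * q3 u) by rewrite c2.
  have d2 : q2 I * (q2 I * q3 u) = q2 I * (q3 I * q2 u) by rewrite c1.
  have : q3 u * (q1 I ^+ 2 + q2 I ^+ 2 + q3 I ^+ 2) = q3 u by rewrite hn mulr1.
  lra.
Qed.

Lemma quat_splitP I J q : imag_unit I -> imag_unit J -> perp I J ->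
  [/\ slice I (split_fst I q), slice I (split_snd I J q) &
      q = split_fst I q + split_snd I J q * J].
Proof.
move=> hI hJ hIJ; have aIJ := imag_unit_anticomm hI hJ hIJ.
have III p : I * (I * p) = - p by rewrite mulrA hI mulN1r.
have pII p : p * I * I = - p by rewrite -mulrA hI mulrN1.
split.
- apply: comm_slice => //; rewrite /split_fst -scalerAr -scalerAl; congr (_ *: _).
  by rewrite mulrBr mulrBl pII -!mulrA III !opprK addrC.
- apply: comm_slice => //; rewrite /split_snd.
  set A := 2^-1 *: _.
  have IA : I * A = - (A * I).
    rewrite /A -scalerAr -scalerAl -scalerN; congr (_ *: _).
    by rewrite mulrDr mulrDl pII -(mulrA I q I) III opprD opprK addrC.
  by rewrite mulrA mulrN IA opprK -(mulrA (- A)) aIJ mulrNN mulrA.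
- rewrite /split_fst /split_snd -(mulrA _ J J) hJ mulrN1 opprK -scalerDr addrACA.
  by rewrite addNr addr0 -(mulr2n q) -(scaler_nat 2 q) scalerA mulVf ?scale1r.
Qed.

Lemma quat_split_unique I J u v : imag_unit I -> imag_unit J -> perp I J ->
  slice I u -> slice I v ->
  split_fst I (u + v * J) = u /\ split_snd I J (u + v * J) = v.
Proof.
move=> hI hJ hIJ /slice_comm cu /slice_comm cv.
have aIJ := imag_unit_anticomm hI hJ hIJ.
have e : I * (u + v * J) * I = - u + v * J.
  rewrite mulrDr mulrDl cu -(mulrA u) hI mulrN1; congr (_ + _).
  rewrite (mulrA I v J) cv -(mulrA (v * I)) aIJ mulrN (mulrA (v * I)).
  by rewrite -(mulrA v I I) hI mulrN1 mulNr opprK.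
have half p : 2^-1 *: (p + p) = p.
  by rewrite -(mulr2n p) -(scaler_nat 2 p) scalerA mulVf ?scale1r// pnatr_eq0.
rewrite /split_fst /split_snd e; split.
  by rewrite opprD opprK addrACA subrr addr0 half.
by rewrite addrACA subrr add0r half mulNr -(mulrA _ J J) hJ mulrN1 opprK.
Qed.

Lemma Phi_splits I J h F G : imag_unit I -> imag_unit J -> perp I J ->
  (forall z, slice I z -> slice I (F z)) ->
  (forall z, slice I z -> slice I (G z)) ->
  splits I J h F G ->
  forall z, slice I z -> Phi I J h z = splitmx F G z.
Proof.
move=> hI hJ hIJ sF sG hFG z hz.
have conj_slice w : slice I w -> slice I (quat_conj w).
  move=> [x [y ->]]; exists x, (- y); have /imag_unitP[i0 _] := hI.
  by apply: eq_quat; rewrite oneqE /quat_conj !qE ?i0; ring.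
have e w : slice I w ->
    split_fst I (h w) = F w /\ split_snd I J (h w) = G w.
  by move=> hw; rewrite (hFG w hw); apply: quat_split_unique; auto.
have [e1 e2] := e z hz; have [e3 e4] := e _ (conj_slice z hz).
by apply/matrixP => i j; rewrite !mxE /sharp /= e1 e2 e3 e4.
Qed.

End Splitting.

Section Coefficients.
Variable R : realType.

Let cvg_pseries_diffs (c : R^nat) : (forall x, cvgn (pseries c x)) ->
  forall x, cvgn (pseries (pseries_diffs c) x).
Proof.
move=> cc x; apply: normed_cvg; pose y := 2 * `|x| + 1.
have y1 : 1 <= y by rewrite /y lerDr mulr_ge0.
have y0 : 0 <= y by rewrite (le_trans ler01).
have cy : cvgn (series (fun n => `|c n.+1| * y ^+ n.+1)).
  have cy : cvgn (pseries (fun n => `|c n|) y).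
    apply: (@is_cvg_pseries_inside_norm R _ (y + 1)); first exact: cc.
    by rewrite !ger0_norm ?ltrDl// addr_ge0.
  rewrite (_ : series _ = fun n =>
      series (fun i => `|c i| * y ^+ i) n.+1 - `|c 0%N| * y ^+ 0); last first.
    by apply/funext => n; rewrite /series/= big_nat_recl// addrAC subrr add0r.
  move/cvg_ex: cy => [l cyl]; apply/cvg_ex; exists (l - `|c 0%N| * y ^+ 0).
  by apply: cvgB; [rewrite (cvg_shiftS (series _))|exact: cvg_cst].
move: cy; apply: series_le_cvg => [n|n|n] /=; [by []|by rewrite mulr_ge0 ?exprn_ge0|].
rewrite /pseries_diffs !normrM normr_nat mulrAC mulrC ler_wpM2l//.
apply: (@le_trans _ _ (y ^+ n)); last by rewrite exprS ler_peMl ?exprn_ge0.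
apply: (@le_trans _ _ ((2 * `|x|) ^+ n)); last first.
  by rewrite lerXn2r ?nnegrE ?mulr_ge0// /y lerDl.
rewrite normrX exprMn ler_wpM2r ?exprn_ge0// -natrX ler_nat.
exact: ltn_expl.
Qed.

Let iter_pseries_diffs n (d : R^nat) i :
  i`!%:R * iter n (@pseries_diffs R) d i = (i + n)`!%:R * d (i + n)%N.
Proof.
elim: n i => [|n IHn] i; first by rewrite addn0.
by rewrite iterS /pseries_diffs mulrA -natrM mulnC -factS IHn addSnnS.
Qed.

Lemma qcoefE (f : quat R -> quat R) (a : nat -> quat R) :
  (forall x : R, series (fun n => x%:A ^+ n * a n) @ \oo --> f x%:A) ->
  qcoef f = a.
Proof.
move=> fa; pose c k n := a n ord0 k.
have fc k x : pseries (c k) x @ \oo --> f x%:A ord0 k.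
  rewrite (_ : pseries _ _ =
    (fun N : quat R => N ord0 k) \o series (fun n => x%:A ^+ n * a n)); last first.
    apply/funext => n; rewrite /= /pseries /series/= summxE.
    apply: eq_bigr => i _.
    by rewrite exprZn expr1n -scalerAl mul1r mxE mulrC.
  by apply: continuous_cvg; [exact: coord_continuous|exact: fa].
have cc n k x : cvgn (pseries (iter n (@pseries_diffs R) (c k)) x).
  elim: n x => [|n IHn] x; last exact: cvg_pseries_diffs.
  by apply/cvg_ex; exists (f x%:A ord0 k); exact: fc.
have D n : derive1n n (fun x : R => f x%:A) =
    fun x => \row_k limn (pseries (iter n (@pseries_diffs R) (c k)) x).
  elim: n => [|n IHn].
    apply/funext => x; apply/rowP => k; rewrite mxE; apply/esym/cvg_lim => //.
    exact: fc.
  rewrite derive1nS IHn; apply/funext => x; rewrite derive1E.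
  have dk k : is_derive x (1 : R)
      (fun x => limn (pseries (iter n (@pseries_diffs R) (c k)) x))
      (limn (pseries (iter n.+1 (@pseries_diffs R) (c k)) x)).
    apply: (@pseries_snd_diffs _ _ (`|x| + 1));
      [exact: cc|exact: (cc n.+1)|exact: (cc n.+2)|].
    by rewrite [ltRHS]ger0_norm ?ltrDl// addr_ge0.
  rewrite derive_mx.
    apply/rowP => k; rewrite !mxE.
    by under eq_fun do rewrite mxE; exact: derive_val.
  apply/derivable_mxP => i k.
  by under eq_fun do rewrite mxE; exact: ex_derive.
have lim0 (d : R^nat) : limn (pseries d 0) = d 0%N.
  apply/cvg_lim => //; rewrite -cvg_shiftS /pseries.
  rewrite (_ : (fun _ => _) = fun=> d 0%N); first exact: cvg_cst.
  apply/funext => n; rewrite /series/= big_nat_recl// expr0 mulr1 big1 ?addr0//.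
  by move=> i _; rewrite expr0n mulr0.
apply/funext => n; rewrite /qcoef D; apply/rowP => k; rewrite !mxE lim0.
have := iter_pseries_diffs n (c k) 0; rewrite fact0 mul1r add0n => ->.
by rewrite mulrA mulVf ?mul1r// pnatr_eq0 -lt0n fact_gt0.
Qed.

End Coefficients.

(* Main.v *)
Require Import Defs.
From mathcomp Require Import all_boot all_order all_algebra.
From mathcomp Require Import all_classical all_reals all_analysis.
From mathcomp Require Import zify ring lra.
Import Order.TTheory GRing.Theory Num.Theory.
Import numFieldNormedType.Exports.
Local Open Scope classical_set_scope.
Local Open Scope ring_scope.
Set Implicit Arguments.
Unset Strict Implicit.
Unset Printing Implicit Defensive.

(* On the slice of I the star product with psi = P + Q J acts by
   (psi * g)(z) = P(z) g(z) + Q(z) J g(conj z), because J z = conj(z) J moves the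
   powers of z past J in the Cauchy product of the two power series.  Hence the
   splitting map Phi_I is multiplicative on star powers, Phi_I(psi^{*n}) = Psi^n,
   and splitting the series \sum_n psi^{*n}(z) (F_n + G_n J) term by term gives
   the formulas.  All convergence questions reduce to a majorant: for the
   submultiplicative norm qnorm, a bound M for \sum_m |b_m| r^m, with b_m the
   coefficients of psi, bounds the corresponding sum for psi^{*n} by a constant
   times M^n, while the coefficients of F and G decay faster than any geometric
   sequence. *)

(** * A submultiplicative norm on the quaternions and continuity of their product *)

Section QuatNorm.
Variable R : realType.
Local Notation H := (quat R).
Implicit Types p q : H.

Lemma q0N p : q0 (- p) = - q0 p. Proof. by rewrite -scaleN1r q0Z mulN1r. Qed.
Lemma q1N p : q1 (- p) = - q1 p. Proof. by rewrite -scaleN1r q1Z mulN1r. Qed.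
Lemma q2N p : q2 (- p) = - q2 p. Proof. by rewrite -scaleN1r q2Z mulN1r. Qed.
Lemma q3N p : q3 (- p) = - q3 p. Proof. by rewrite -scaleN1r q3Z mulN1r. Qed.
Definition quatE := (q0E, q1E, q2E, q3E, q0D, q1D, q2D, q3D, q0Z, q1Z, q2Z,
  q3Z, q0N, q1N, q2N, q3N).

Lemma quat_mulE p q : p * q = quat_mul p q. Proof. by []. Qed.

Lemma quat_oneE : 1 = mkquat 1 0 0 0 :> H. Proof. by []. Qed.

Lemma quat_coord_le p k : `|p ord0 k| <= `|p|.
Proof.
by rewrite [leRHS]/Num.norm/= mx_normrE; apply: (le_bigmax _ _ (ord0, k)).
Qed.

Lemma quat_norm_le p (M : R) : `|q0 p| <= M -> `|q1 p| <= M ->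
  `|q2 p| <= M -> `|q3 p| <= M -> `|p| <= M.
Proof.
move=> h0 h1 h2 h3; rewrite [leLHS]/Num.norm/= mx_normrE.
apply: bigmax_le => [|[i j] _]; first exact: le_trans h0.
rewrite /= (ord1 i) -(inord_val j).
by case: j => -[|[|[|[|//]]]] ?; [exact: h0|exact: h1|exact: h2|exact: h3].
Qed.

Lemma norm_sum4 (a b c d M : R) : `|a| <= M -> `|b| <= M -> `|c| <= M ->
  `|d| <= M -> `|a + b + c + d| <= 4 * M.
Proof. by rewrite !ler_norml => /andP[? ?] /andP[? ?] /andP[? ?] /andP[? ?]; lra. Qed.

(* The sup norm itself is not submultiplicative: |p q| <= 4 |p| |q|. *)
Definition qnorm p : R := 4 * `|p|.

Lemma qnorm_ge0 p : 0 <= qnorm p. Proof. by rewrite mulr_ge0. Qed.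

Lemma norm_le_qnorm p : `|p| <= qnorm p.
Proof. by rewrite /qnorm; have := normr_ge0 p; lra. Qed.

(** Each coordinate of a product is a signed sum of four products of coordinates; the factor 4 is
    absorbed into [qnorm q]. *)
Lemma quat_normM p q : `|p * q| <= `|p| * qnorm q.
Proof.
have h i j : `|p ord0 i * q ord0 j| <= `|p| * `|q|.
  by rewrite normrM ler_pM// quat_coord_le.
have hN i j : `|- (p ord0 i * q ord0 j)| <= `|p| * `|q|.
  by rewrite normrN.
by rewrite /qnorm mulrCA; apply: quat_norm_le;
  rewrite quat_mulE /quat_mul !quatE; apply: norm_sum4;
  solve [exact: h | exact: hN].
Qed.

Lemma qnormM p q : qnorm (p * q) <= qnorm p * qnorm q.
Proof. by rewrite {1 2}/qnorm -mulrA ler_wpM2l// quat_normM. Qed.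

Lemma qnormD p q : qnorm (p + q) <= qnorm p + qnorm q.
Proof. by rewrite /qnorm -mulrDr ler_wpM2l// ler_normD. Qed.

Lemma qnorm_sum (T : Type) (s : seq T) (P : pred T) (u : T -> H) :
  qnorm (\sum_(i <- s | P i) u i) <= \sum_(i <- s | P i) qnorm (u i).
Proof. by rewrite /qnorm -mulr_sumr ler_wpM2l// ler_norm_sum. Qed.

Lemma quat_norm1 : `|1 : H| <= 1.
Proof. by apply: quat_norm_le; rewrite quat_oneE quatE ?normr1 ?normr0. Qed.

(** The left side keeps the sup norm because [qnorm 1] is 4, so the case [n = 0] would fail for
    [qnorm]. The same 4 is why a factor [qnorm 1] accompanies later bounds on powers. *)
Lemma quat_normX p n : `|p ^+ n| <= qnorm p ^+ n.
Proof.
elim: n => [|n IH]; first by rewrite !expr0 quat_norm1.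
rewrite exprSr (le_trans (quat_normM _ _))// exprSr.
by rewrite ler_wpM2r// qnorm_ge0.
Qed.

Lemma cvg0_dominated (w : nat -> H) (r : nat -> R) :
  (forall n, `|w n| <= r n) -> r @ \oo --> (0 : R) -> w @ \oo --> (0 : H).
Proof.
move=> wr r0; apply: norm_cvg0.
have h : \forall n \near \oo, (fun=> 0) n <= `|w n| <= r n.
  by near=> n; rewrite normr_ge0 wr.
exact: (squeeze_cvgr h (cvg_cst _) r0).
Unshelve. all: by end_near. Qed.

Lemma cvg_dominated (w : nat -> H) (l : H) (r : nat -> R) :
  (forall n, `|w n - l| <= r n) -> r @ \oo --> (0 : R) -> w @ \oo --> l.
Proof. by move=> wr r0; apply/subr_cvg0; exact: cvg0_dominated wr r0. Qed.

Lemma quat_cvgM (u v : nat -> H) (l m : H) : u @ \oo --> l -> v @ \oo --> m ->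
  (fun n => u n * v n) @ \oo --> l * m.
Proof.
move=> ul vm.
have u0 : (fun n => `|u n - l|) @ \oo --> (0 : R).
  by rewrite -(normr0 H); apply: cvg_norm; apply/subr_cvg0.
have v0 : (fun n => `|v n - m|) @ \oo --> (0 : R).
  by rewrite -(normr0 H); apply: cvg_norm; apply/subr_cvg0.
apply: (@cvg_dominated _ _
  (fun n => `|u n - l| * (4 * `|v n|) + `|l| * (4 * `|v n - m|))) => [n|].
  have -> : u n * v n - l * m = (u n - l) * v n + l * (v n - m).
    by rewrite mulrBl mulrBr addrA subrK.
  by rewrite (le_trans (ler_normD _ _))// lerD// quat_normM.
rewrite [X in _ --> X](_ : 0 = 0 * (4 * `|m|) + `|l| * (4 * 0) :> R); last by ring.
  apply: cvgD.
    by apply: cvgM => //; apply: cvgM; [exact: cvg_cst|exact: cvg_norm].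
  apply: cvgM; first exact: cvg_cst.
  by apply: cvgM => //; exact: cvg_cst.
Qed.

Lemma quat_cvgMl p (u : nat -> H) (l : H) :
  u @ \oo --> l -> (fun n => p * u n) @ \oo --> p * l.
Proof. by apply: quat_cvgM; exact: cvg_cst. Qed.

Lemma quat_cvgMr p (u : nat -> H) (l : H) :
  u @ \oo --> l -> (fun n => u n * p) @ \oo --> l * p.
Proof. by move=> ul; apply: quat_cvgM => //; exact: cvg_cst. Qed.

End QuatNorm.

(** * Cauchy products of absolutely convergent quaternionic series *)

Section CauchyProduct.

Definition cauchy_prod (T : pzRingType) (u v : nat -> T) (n : nat) : T :=
  \sum_(k < n.+1) u k * v (n - k)%N.

(** Both sides sum [u k * v j] over the triangle [k + j < N], by diagonals on the left and by rows
    on the right. *)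
Lemma sum_cauchy_prod (T : pzRingType) (u v : nat -> T) N :
  \sum_(n < N) cauchy_prod u v n =
  \sum_(k < N) u k * \sum_(j < (N - k)%N) v j.
Proof.
elim: N => [|N IH]; first by rewrite !big_ord0.
rewrite big_ord_recr/= IH /cauchy_prod [in LHS]big_ord_recr/= [RHS]big_ord_recr/=.
rewrite addrA -big_split/= subnn subSn// subnn big_ord1; congr (_ + _).
apply: eq_bigr => k _; rewrite -mulrDr subSn 1?ltnW// big_ord_recr//.
Qed.

Lemma sum_cauchy_prod_le (R : realDomainType) (a b : nat -> R) (A B : R) :
  (forall n, 0 <= a n) -> (forall n, 0 <= b n) ->
  (forall N, \sum_(n < N) a n <= A) -> (forall N, \sum_(n < N) b n <= B) ->
  forall N, \sum_(n < N) cauchy_prod a b n <= A * B.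
Proof.
move=> a0 b0 hA hB N; rewrite sum_cauchy_prod.
apply: (@le_trans _ _ (\sum_(k < N) a k * B)).
  by apply: ler_sum => k _; rewrite ler_wpM2l.
rewrite -mulr_suml ler_wpM2r//.
by apply: le_trans (hB 0%N); rewrite big_ord0.
Qed.

Variable R : realType.
Local Notation H := (quat R).
Implicit Types u v : nat -> H.

(** Absolute convergence with an explicit bound, so that the bound also passes to the norm of the
    sum. *)
Definition abs_bounded u (M : R) := forall N, \sum_(n < N) `|u n| <= M.

Lemma abs_bounded_cvg_norm u M : abs_bounded u M ->
  cvgn (fun N => \sum_(n < N) `|u n|).
Proof.
move=> uM; apply: nondecreasing_is_cvgn.
  by apply/nondecreasing_seqP => N; rewrite big_ord_recr/= lerDl.
by exists M => _ [N _ <-].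
Qed.

Lemma abs_bounded_cvg u M : abs_bounded u M -> cvgn (series u).
Proof.
move=> uM; apply: (@normed_cvg R H).
rewrite (_ : [normed series u] = fun N => \sum_(n < N) `|u n|).
  exact: abs_bounded_cvg_norm uM.
by apply/funext => N; rewrite /normed_series_of seriesEnat/= big_mkord.
Qed.

Lemma abs_bounded_lim_le u M (l : H) : abs_bounded u M -> series u @ \oo --> l ->
  `|l| <= M.
Proof.
move=> uM /(cvg_norm (K := R)) ul.
rewrite -(cvg_lim _ ul)//; apply: limr_le; first by apply/cvg_ex; exists `|l|.
near=> N; rewrite /series/= big_mkord.
exact: le_trans (ler_norm_sum _ _ _) (uM N).
Unshelve. all: by end_near. Qed.

(** Needed for the half square that appears in [cauchy_prod_dist]. *)
Lemma cvg_half (v : nat -> R) (l : R) : v @ \oo --> l -> (fun n => v n./2) @ \oo --> l.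
Proof.
move=> vl; apply: (cvg_comp (fun n => n./2) v _ vl) => A [N _ NA].
exists N.*2 => // n /= Nn; apply: NA => /=.
by rewrite -(doubleK N) half_leq.
Qed.

Lemma big_ordB (T : zmodType) (f : nat -> T) m n : (m <= n)%N ->
  \sum_(k < n) f k - \sum_(k < m) f k = \sum_(m <= k < n) f k.
Proof.
move=> mn; rewrite -!(big_mkord xpredT f) (big_cat_nat _ mn)//=.
by rewrite addrAC subrr add0r.
Qed.

(** The difference sums [u k * v j] over the part [k + j >= N] of the square of side [N]. No such
    pair lies in the square of side [N./2], so the large square minus the small one bounds it; the 4
    comes from [quat_normM]. *)
Lemma cauchy_prod_dist u v N :
  `|series u N * series v N - series (cauchy_prod u v) N| <=
  4 * ((\sum_(n < N) `|u n|) * (\sum_(n < N) `|v n|)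
     - (\sum_(n < N./2) `|u n|) * (\sum_(n < N./2) `|v n|)).
Proof.
rewrite /series/= !big_mkord sum_cauchy_prod mulr_suml -sumrB.
have mono (a : nat -> R) m n : (forall k, 0 <= a k) -> (m <= n)%N ->
    \sum_(k < m) a k <= \sum_(k < n) a k.
  by move=> a0 mn; rewrite -subr_ge0 big_ordB// sumr_ge0.
pose b n := \sum_(k < n) `|v k|.
apply: (@le_trans _ _ (4 * \sum_(k < N) `|u k| * (b N - b (N - k)%N))).
  rewrite (le_trans (ler_norm_sum _ _ _))// mulr_sumr.
  apply: ler_sum => k _; rewrite -mulrBr (le_trans (quat_normM _ _))//.
  rewrite /qnorm mulrCA ler_wpM2l// ler_wpM2l//.
  by rewrite /b big_ordB ?leq_subr//
    (big_ordB (fun i => `|v i|)) ?leq_subr// ler_norm_sum.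
rewrite ler_wpM2l//.
under [leLHS]eq_bigr do rewrite mulrBr.
rewrite sumrB -mulr_suml lerB//.
have hN : (N./2 <= N)%N by rewrite -{2}(odd_double_half N) -addnn; lia.
rewrite mulr_suml -(big_mkord xpredT (fun k => `|u k| * b (N - k)%N)).
(* The rows with [k >= N./2] are nonnegative and are dropped; in the others [N - k >= N./2], so each
   still contains a full row of the small square. *)
rewrite (big_cat_nat _ hN)//= -[leLHS]addr0 lerD//; last first.
  by apply: sumr_ge0 => k _; rewrite mulr_ge0// sumr_ge0.
rewrite big_mkord; apply: ler_sum => k _; rewrite ler_wpM2l//.
apply: (mono (fun i => `|v i|)) => //.
have := ltn_ord k; have := odd_double_half N; rewrite -addnn; lia.
Qed.

(** The product of the partial sums tends to [U * V], and its distance to the partial sums of the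
    Cauchy product vanishes: both squares in [cauchy_prod_dist] have the same limit [a * b]. *)
Lemma cvg_cauchy_prod u v M M' (U V : H) : abs_bounded u M -> abs_bounded v M' ->
  series u @ \oo --> U -> series v @ \oo --> V ->
  series (cauchy_prod u v) @ \oo --> U * V.
Proof.
move=> uM vM uU vV.
have /cvg_ex[a ua] := abs_bounded_cvg_norm uM.
have /cvg_ex[b vb] := abs_bounded_cvg_norm vM.
have ab : (fun N => (\sum_(n < N) `|u n|) * (\sum_(n < N) `|v n|)) @ \oo
    --> a * b by exact: cvgM.
rewrite -[U * V]subr0.
have -> : series (cauchy_prod u v) = fun N => series u N * series v N -
    (series u N * series v N - series (cauchy_prod u v) N).
  by apply/funext => N; rewrite opprB addrCA subrr addr0.
apply: cvgB; first exact: quat_cvgM.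
apply: (@cvg0_dominated _ _ (fun N =>
  4 * ((\sum_(n < N) `|u n|) * (\sum_(n < N) `|v n|)
     - (\sum_(n < N./2) `|u n|) * (\sum_(n < N./2) `|v n|)))) => [N|].
  exact: cauchy_prod_dist.
rewrite [X in _ --> X](_ : 0 = 4 * (a * b - a * b)); last by rewrite subrr mulr0.
  apply: cvgM; first exact: cvg_cst.
  by apply: cvgB; [exact: ab|exact: (cvg_half ab)].
Qed.

End CauchyProduct.

(** * Majorants of coefficient sequences, and convergence of star powers, compositions and matrix
    functions *)

Section Coefficients.
Variable R : realType.
Local Notation H := (quat R).
Implicit Types (b c d : nat -> H) (r M : R) (f g psi : H -> H).

Definition majorized d r M := forall N, \sum_(m < N) r ^+ m * qnorm (d m) <= M.

(** Infinite radius of convergence, phrased through majorants because these behave well under sums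
    and Cauchy products. *)
Definition entire_coef d := forall r, 0 <= r -> exists M, majorized d r M.

Definition power_term (xi : H) d (m : nat) : H := xi ^+ m * d m.

Lemma majorized_ge0 d r M : majorized d r M -> 0 <= M.
Proof. by move=> /(_ 0%N); rewrite big_ord0. Qed.

Lemma abs_bounded_power_term d xi M :
  majorized d (qnorm xi) M -> abs_bounded (power_term xi d) M.
Proof.
move=> dM N; apply: le_trans (dM N); apply: ler_sum => m _.
by rewrite (le_trans (quat_normM _ _))// ler_wpM2r ?qnorm_ge0// quat_normX.
Qed.

Lemma entire_coef_abs_bounded d xi : entire_coef d ->
  exists M, abs_bounded (power_term xi d) M.
Proof.
by move=> /(_ _ (qnorm_ge0 xi))[M dM]; exists M; exact: abs_bounded_power_term.
Qed.

(** Submultiplicativity of [qnorm] and the factorisation of [r ^+ m] as [r ^+ k * r ^+ (m - k)]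
    bound the terms by the real Cauchy product of the two majorizing series. *)
Lemma majorized_cauchy_prod b d r M M' : 0 <= r ->
  majorized b r M -> majorized d r M' -> majorized (cauchy_prod b d) r (M * M').
Proof.
move=> r0 bM dM N.
have t0 c m : 0 <= r ^+ m * qnorm (c m) by rewrite mulr_ge0 ?exprn_ge0 ?qnorm_ge0.
apply: le_trans (sum_cauchy_prod_le (t0 b) (t0 d) bM dM N).
apply: ler_sum => m _.
apply: (@le_trans _ _ (r ^+ m * \sum_(k < m.+1) qnorm (b k) * qnorm (d (m - k)%N))).
  rewrite ler_wpM2l ?exprn_ge0// (le_trans (qnorm_sum _ _ _))//.
  by apply: ler_sum => k _; exact: qnormM.
rewrite mulr_sumr; apply: ler_sum => k _.
have km : (k <= m)%N by rewrite -ltnS.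
by rewrite -{1}(subnKC km) exprD mulrACA.
Qed.

Lemma entire_coef_mulr d p : entire_coef d -> entire_coef (fun n => d n * p).
Proof.
move=> hd r r0; have [M dM] := hd r r0; exists (M * qnorm p) => N.
apply: (@le_trans _ _ ((\sum_(m < N) r ^+ m * qnorm (d m)) * qnorm p)).
  rewrite mulr_suml; apply: ler_sum => m _.
  by rewrite -mulrA ler_wpM2l ?exprn_ge0// qnormM.
by rewrite ler_wpM2r ?qnorm_ge0.
Qed.

Lemma entire_coefD c d : entire_coef c -> entire_coef d ->
  entire_coef (fun n => c n + d n).
Proof.
move=> hc hd r r0; have [M cM] := hc r r0; have [M' dM] := hd r r0.
exists (M + M') => N.
apply: le_trans (lerD (cM N) (dM N)); rewrite -big_split/=.
by apply: ler_sum => m _; rewrite -mulrDr ler_wpM2l ?exprn_ge0// qnormD.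
Qed.

Lemma real_quatX (x : R) n : (x%:A : H) ^+ n = (x ^+ n)%:A.
Proof. by rewrite exprZn expr1n. Qed.

(* The terms at the real point 2 r are bounded by some K, so those at r are at
   most K / 2 ^ n. *)
Lemma cvg_real_entire_coef d :
  (forall x : R, cvgn (series (power_term x%:A d))) -> entire_coef d.
Proof.
move=> cd r r0.
have /cvg_series_cvg_0/cvgP/cvg_seq_bounded[K [_ hK]] := cd (2 * r).
(* Boundedness only supplies bounds strictly above [K], hence the [+ 1]. *)
have {}hK n : (2 * r) ^+ n * `|d n| <= `|K| + 1.
  have := hK (`|K| + 1); rewrite (le_lt_trans (ler_norm _)) ?ltrDl//.
  move=> /(_ isT n I); rewrite /= /power_term real_quatX -scalerAl mul1r normrZ.
  by rewrite ger0_norm// exprn_ge0// mulr_ge0.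
(* The 4 is the factor in [qnorm], the last factor the sum of the geometric series of ratio
   [2^-1]. *)
exists (4 * (`|K| + 1) * (1 - 2^-1)^-1) => N.
have h2 : `|2^-1 : R| < 1 by rewrite ger0_norm ?invr_ge0// invf_lt1// ltr1n.
have K0 : 0 <= 4 * (`|K| + 1) by rewrite mulr_ge0// addr_ge0.
have i2 : 0 < 2^-1 :> R by rewrite invr_gt0.
apply: le_trans (geometric_le_lim N K0 i2 h2).
rewrite /series/= big_mkord; apply: ler_sum => m _.
rewrite /qnorm mulrCA -mulrA ler_wpM2l//= exprVn ler_pdivlMr ?exprn_gt0//.
by rewrite [leLHS](_ : _ = (2 * r) ^+ m * `|d m|) ?hK// exprMn; ring.
Qed.

Definition one_coef (m : nat) : H := (m == 0)%:R.

Lemma majorized_one_coef r : majorized one_coef r (qnorm 1).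
Proof.
case=> [|N]; first by rewrite big_ord0 qnorm_ge0.
rewrite big_ord_recl/= expr0 mul1r big1 ?addr0// => i _.
by rewrite /qnorm normr0 !mulr0.
Qed.

Definition starpow_coef b n := iter n (cauchy_prod b) one_coef.

(** Each star factor contributes one [M]; the growth in [n] is thus geometric, which the
    coefficients of an entire function outweigh. *)
Lemma majorized_starpow_coef b r M n : 0 <= r -> majorized b r M ->
  majorized (starpow_coef b n) r (M ^+ n * qnorm 1).
Proof.
move=> r0 bM; elim: n => [|n IH]; first by rewrite mul1r; exact: majorized_one_coef.
by rewrite exprS -mulrA; exact: majorized_cauchy_prod.
Qed.

Lemma entire_starpow_coef b n : entire_coef b -> entire_coef (starpow_coef b n).
Proof.
move=> hb r r0; have [M bM] := hb r r0.
by exists (M ^+ n * qnorm 1); exact: majorized_starpow_coef.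
Qed.

Lemma star_seriesE f g xi : star_series f g xi =
  series (power_term xi (cauchy_prod (qcoef f) (qcoef g))).
Proof. by []. Qed.

(** [star] reads the coefficients of its arguments through [qcoef]. The induction hypothesis at real
    points and [qcoefE] identify those of the [n]-th star power, so the next one is the sum of an
    explicit convergent series. *)
Lemma starpow_expansion psi n xi : entire_coef (qcoef psi) ->
  series (power_term xi (starpow_coef (qcoef psi) n)) @ \oo --> starpow psi n xi.
Proof.
move=> hb; elim: n xi => [|n IH] xi.
  (* The empty partial sum is 0; after the shift the sequence is constantly 1. *)
  rewrite -cvg_shiftS /=.
  rewrite (_ : (fun _ => _) = fun=> 1); first exact: cvg_cst.
  apply/funext => N; rewrite /series/= big_nat_recl//= big1 ?addr0.
    by rewrite /power_term expr0 mul1r.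
  by move=> i _; rewrite /power_term mulr0.
have e : qcoef (starpow psi n) = starpow_coef (qcoef psi) n.
  by apply: qcoefE => x; exact: IH.
(* By definition [starpow_coef _ n.+1] is the Cauchy product of [qcoef psi] with [starpow_coef _ n],
   so this bounds the series defining the next star power. *)
have [M hM] := entire_coef_abs_bounded xi (entire_starpow_coef n.+1 hb).
rewrite /starpow iterS -/(starpow psi n) /star star_seriesE e.
exact: abs_bounded_cvg hM.
Qed.

Lemma qcoef_starpow psi n : entire_coef (qcoef psi) ->
  qcoef (starpow psi n) = starpow_coef (qcoef psi) n.
Proof. by move=> hb; apply: qcoefE => x; exact: starpow_expansion. Qed.

Lemma star_series_starpow_cvg psi n xi : entire_coef (qcoef psi) ->
  cvgn (star_series psi (starpow psi n) xi).
Proof.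
move=> hb; rewrite star_seriesE qcoef_starpow//.
have [M hM] := entire_coef_abs_bounded xi (entire_starpow_coef n.+1 hb).
exact: abs_bounded_cvg hM.
Qed.

Lemma starpow_norm_le psi xi M n : entire_coef (qcoef psi) ->
  majorized (qcoef psi) (qnorm xi) M -> `|starpow psi n xi| <= M ^+ n * qnorm 1.
Proof.
move=> hb hM; apply: (abs_bounded_lim_le _ (starpow_expansion hb)).
by apply: abs_bounded_power_term; apply: majorized_starpow_coef => //; exact: qnorm_ge0.
Qed.

(** Common convergence criterion for [scomp_series], with star powers as [w], and for
    [mxfun_series], with entries of matrix powers as [w]. *)
Lemma geometric_terms_cvg (w : nat -> H) c C r : entire_coef c -> 0 <= r ->
  (forall n, `|w n| <= r ^+ n * C) -> cvgn (series (fun n => w n * c n)).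
Proof.
move=> hc r0 wC; have [M cM] := hc r r0.
have C0 : 0 <= C by have := wC 0%N; rewrite expr0 mul1r; exact: le_trans.
apply: (@abs_bounded_cvg _ _ (C * M)) => N.
apply: le_trans (ler_wpM2l C0 (cM N)); rewrite mulr_sumr; apply: ler_sum => n _.
by rewrite (le_trans (quat_normM _ _))// [leRHS]mulrA (mulrC C) ler_wpM2r ?qnorm_ge0.
Qed.

Lemma scomp_series_cvg f psi xi : entire_coef (qcoef f) ->
  entire_coef (qcoef psi) -> cvgn (scomp_series f psi xi).
Proof.
move=> ha hb; have [M bM] := hb _ (qnorm_ge0 xi).
apply: geometric_terms_cvg ha (majorized_ge0 bM) _ => n.
exact: starpow_norm_le.
Qed.

(** Multiplying by [A] on the left costs at most the sum of [qnorm] over one row of [A]; the sum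
    over all entries bounds it uniformly in the row. *)
Lemma quat_mx_pow_le (A : 'M[H]_2) n i j :
  qnorm ((A ^+ n) i j) <= (\sum_k \sum_l qnorm (A k l)) ^+ n * qnorm 1.
Proof.
elim: n i j => [|n IH] i j.
  rewrite !expr0 mul1r mxE; case: (i == j) => //=.
  by rewrite /qnorm normr0 mulr0 mulr_ge0.
rewrite exprS mxE (le_trans (qnorm_sum _ _ _))// exprS -mulrA.
set S := \sum_k \sum_l _.
have rows_ge0 k : 0 <= \sum_l qnorm (A k l).
  by apply: sumr_ge0 => l _; exact: qnorm_ge0.
apply: (@le_trans _ _ ((\sum_l qnorm (A i l)) * (S ^+ n * qnorm 1))).
  rewrite mulr_suml; apply: ler_sum => k _.
  by rewrite (le_trans (qnormM _ _))// ler_wpM2l ?qnorm_ge0.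
rewrite ler_wpM2r//.
  by rewrite mulr_ge0 ?qnorm_ge0// exprn_ge0// sumr_ge0.
by rewrite /S [leRHS](bigD1 i)//= lerDl sumr_ge0.
Qed.

Lemma mxfun_series_entry phi (A : 'M[H]_2) N i j :
  mxfun_series phi A N i j = series (fun n => (A ^+ n) i j * qcoef phi n) N.
Proof.
rewrite /mxfun_series /series/= summxE; apply: eq_bigr => n _.
rewrite mxE (bigD1 j)//= big1 ?addr0 => [|k kj]; first by rewrite mxE eqxx.
by rewrite mxE (negbTE kj) mulr0n mulr0.
Qed.

(** Convergence is compared through entourages; for the converse, finitely many entries allow the
    eventual conditions to be intersected. *)
Lemma cvg_quat_mxP (u : nat -> 'M[H]_2) (L : 'M[H]_2) :
  u @ \oo --> L <-> forall i j, (fun n => u n i j) @ \oo --> L i j.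
Proof.
split=> [uL i j|uL].
  apply/cvg_app_entourageP => E entE.
  have /cvg_mx_entourageP/(_ E entE) := uL; rewrite near_map.
  by apply: filterS => n /(_ i j); rewrite inE.
apply/cvg_mx_entourageP => E entE; rewrite near_map.
apply: filter_forall => i; apply: filter_forall => j.
have /cvg_app_entourageP/(_ E entE) := uL i j.
by apply: filterS => n; rewrite inE.
Qed.

Lemma mxfun_series_cvg phi (A : 'M[H]_2) : entire_coef (qcoef phi) ->
  cvgn (mxfun_series phi A).
Proof.
move=> hc.
have h i j : cvgn (series (fun n => (A ^+ n) i j * qcoef phi n)).
  apply: (geometric_terms_cvg (r := \sum_k \sum_l qnorm (A k l)) hc).
    by apply: sumr_ge0 => l _; apply: sumr_ge0 => l' _; exact: qnorm_ge0.
  by move=> n; exact: le_trans (norm_le_qnorm _) (quat_mx_pow_le _ _ _ _).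
apply/cvg_ex.
exists (\matrix_(i, j) limn (series (fun n => (A ^+ n) i j * qcoef phi n))).
apply/cvg_quat_mxP => i j; rewrite mxE.
under eq_fun do rewrite mxfun_series_entry.
exact: h.
Qed.

Lemma mxfun_entry phi (A : 'M[H]_2) i j : entire_coef (qcoef phi) ->
  series (fun n => (A ^+ n) i j * qcoef phi n) @ \oo --> mxfun phi A i j.
Proof.
move=> hc; have /cvg_quat_mxP/(_ i j) := mxfun_series_cvg (A := A) hc.
by under eq_fun do rewrite mxfun_series_entry.
Qed.

End Coefficients.

(** * Conjugation, the algebra of a slice, and the splitting of products *)

Section Slices.
Variable R : realType.
Local Notation H := (quat R).
Implicit Types (I J p q u v w z : H).

Lemma quat_conjD p q : quat_conj (p + q) = quat_conj p + quat_conj q.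
Proof. by apply: eq_quat; rewrite /quat_conj !quatE; ring. Qed.

Lemma quat_conjN p : quat_conj (- p) = - quat_conj p.
Proof. by apply: eq_quat; rewrite /quat_conj !quatE; ring. Qed.

Lemma quat_conj_real (x : R) : quat_conj x%:A = x%:A.
Proof. by apply: eq_quat; rewrite quat_oneE /quat_conj !quatE; ring. Qed.

Lemma quat_conj0 : quat_conj 0 = 0 :> H.
Proof. by rewrite -{1}(scale0r 1) quat_conj_real scale0r. Qed.

Lemma quat_conj1 : quat_conj 1 = 1 :> H.
Proof. by rewrite -(scale1r 1) quat_conj_real. Qed.

Lemma quat_conjM p q : quat_conj (p * q) = quat_conj q * quat_conj p.
Proof. by apply: eq_quat; rewrite !quat_mulE /quat_conj /quat_mul !quatE; ring. Qed.

Lemma quat_conjK : involutive (@quat_conj R).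
Proof. by move=> p; apply: eq_quat; rewrite /quat_conj !quatE; ring. Qed.

Lemma quat_conj_norm p : `|quat_conj p| <= `|p|.
Proof.
by apply: quat_norm_le; rewrite /quat_conj !quatE ?normrN quat_coord_le.
Qed.

Lemma quat_conj_sum (T : Type) (s : seq T) (P : pred T) (f : T -> H) :
  quat_conj (\sum_(i <- s | P i) f i) = \sum_(i <- s | P i) quat_conj (f i).
Proof. exact: (big_morph _ quat_conjD quat_conj0). Qed.

Lemma cvg_quat_conj (f : nat -> H) (l : H) :
  f @ \oo --> l -> (fun n => quat_conj (f n)) @ \oo --> quat_conj l.
Proof.
move=> fl.
have h : (fun n => `|f n - l|) @ \oo --> (0 : R).
  by rewrite -(normr0 H); apply: cvg_norm; apply/subr_cvg0.
have hr n : `|quat_conj (f n) - quat_conj l| <= `|f n - l|.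
  by rewrite -quat_conjN -quat_conjD quat_conj_norm.
exact: cvg_dominated hr h.
Qed.

Lemma slice_real I (x : R) : slice I x%:A.
Proof. by exists x, 0; rewrite scale0r addr0. Qed.

Lemma sliceD I u v : slice I u -> slice I v -> slice I (u + v).
Proof.
move=> [x [y ->]] [x' [y' ->]]; exists (x + x'), (y + y').
by rewrite !scalerDl addrACA.
Qed.

Lemma sliceN I u : slice I u -> slice I (- u).
Proof. by move=> [x [y ->]]; exists (- x), (- y); rewrite !scaleNr opprD. Qed.

(** The slice of [I] is the centralizer of [I], which is closed under products. *)
Lemma sliceM I u v : imag_unit I -> slice I u -> slice I v -> slice I (u * v).
Proof.
move=> hI /slice_comm cu /slice_comm cv; apply: comm_slice => //.
by rewrite mulrA cu -mulrA cv mulrA.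
Qed.

Lemma sliceX I u n : imag_unit I -> slice I u -> slice I (u ^+ n).
Proof.
move=> hI hu; elim: n => [|n IH]; last by rewrite exprS; exact: sliceM.
by rewrite expr0 -(scale1r 1); exact: slice_real.
Qed.

Lemma slice_conj I u : imag_unit I -> slice I u -> slice I (quat_conj u).
Proof.
move=> /imag_unitP[i0 _] [x [y ->]]; exists x, (- y).
by apply: eq_quat; rewrite quat_oneE /quat_conj !quatE ?i0; ring.
Qed.

Lemma slice_mulC I u v : slice I u -> slice I v -> u * v = v * u.
Proof.
move=> /slice_comm cu [x [y ->]].
by rewrite mulrDl mulrDr -!scalerAl -!scalerAr cu mul1r mulr1.
Qed.

(** [J] commutes with reals and anticommutes with [I], and conjugation changes exactly the sign of
    the [I] component. *)
Lemma perp_mul_slice I J u : imag_unit I -> imag_unit J -> perp I J ->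
  slice I u -> J * u = quat_conj u * J.
Proof.
move=> hI hJ hIJ [x [y ->]].
have -> : quat_conj (x%:A + y *: I) = x%:A - y *: I.
  have /imag_unitP[i0 _] := hI.
  by apply: eq_quat; rewrite quat_oneE /quat_conj !quatE ?i0; ring.
rewrite mulrDr mulrBl -!scalerAr -!scalerAl mul1r mulr1.
by rewrite (imag_unit_anticomm hI hJ hIJ) scalerN.
Qed.

Lemma quat_conjX u n : quat_conj (u ^+ n) = quat_conj u ^+ n.
Proof.
elim: n => [|n IH]; first by rewrite !expr0 quat_conj1.
by rewrite exprSr quat_conjM IH -exprS.
Qed.

(** Moving [J] to the right conjugates [c] and [d], and [J * J = -1] gives the minus sign. Used both
    for the recurrence of star powers and for each term of the composition series. *)
Lemma split_mul I J u v a b c d : imag_unit I -> imag_unit J -> perp I J ->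
  slice I u -> slice I v -> slice I a -> slice I b -> slice I c -> slice I d ->
  let w := u * (a + b * J) + v * J * (c + d * J) in
  split_fst I w = u * a - v * quat_conj d /\
  split_snd I J w = u * b + v * quat_conj c.
Proof.
move=> hI hJ hIJ hu hv ha hb hc hd /=.
have -> : u * (a + b * J) + v * J * (c + d * J) =
    (u * a - v * quat_conj d) + (u * b + v * quat_conj c) * J.
  have -> : v * J * (c + d * J) = v * quat_conj c * J - v * quat_conj d.
    rewrite mulrDr -!mulrA (mulrA J d) !(perp_mul_slice hI hJ hIJ)//.
    by rewrite -(mulrA _ J J) hJ mulrN1 mulrN.
  by rewrite mulrDr mulrDl mulrA [in LHS](addrC (_ * J)) addrACA.
apply: quat_split_unique => //; apply: sliceD; try exact: sliceM.
- by apply/sliceN/sliceM => //; exact: slice_conj.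
- by apply: sliceM => //; exact: slice_conj.
Qed.

Lemma split_fst_sum I (T : Type) (s : seq T) (f : T -> H) :
  split_fst I (\sum_(i <- s) f i) = \sum_(i <- s) split_fst I (f i).
Proof.
apply: (big_morph (split_fst I)) => [p q|]; rewrite /split_fst.
  by rewrite -scalerDr mulrDr mulrDl opprD addrACA.
by rewrite mulr0 mul0r subrr scaler0.
Qed.

Lemma split_snd_sum I J (T : Type) (s : seq T) (f : T -> H) :
  split_snd I J (\sum_(i <- s) f i) = \sum_(i <- s) split_snd I J (f i).
Proof.
apply: (big_morph (split_snd I J)) => [p q|]; rewrite /split_snd.
  by rewrite -mulrDl -opprD -scalerDr mulrDr mulrDl addrACA.
by rewrite mulr0 mul0r addr0 scaler0 oppr0 mul0r.
Qed.

Lemma cvg_split_fst I (f : nat -> H) (l : H) :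
  f @ \oo --> l -> (fun n => split_fst I (f n)) @ \oo --> split_fst I l.
Proof.
move=> fl; apply: cvgZ; first exact: cvg_cst.
by apply: cvgB => //; apply: quat_cvgMr; exact: quat_cvgMl.
Qed.

Lemma cvg_split_snd I J (f : nat -> H) (l : H) :
  f @ \oo --> l -> (fun n => split_snd I J (f n)) @ \oo --> split_snd I J l.
Proof.
move=> fl; apply: quat_cvgMr; apply: cvgN; apply: cvgZ; first exact: cvg_cst.
by apply: cvgD => //; apply: quat_cvgMr; exact: quat_cvgMl.
Qed.

End Slices.

(** * Entire functions on a slice, and the splitting of star powers and compositions *)

Section EntireFunctions.
Variable R : realType.
Local Notation H := (quat R).
Implicit Types (I J z : H) (f psi F G P Q : H -> H).

(** Real points lie in every slice, so [qcoefE] forces the coefficients witnessing [entire] to be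
    [qcoef F]; convergence at real points already gives [entire_coef]. *)
Lemma entire_qcoef I F : entire I F ->
  [/\ forall n, slice I (qcoef F n), entire_coef (qcoef F) &
      forall z, slice I z -> series (power_term z (qcoef F)) @ \oo --> F z].
Proof.
move=> [_ [c hc cF]].
have -> : qcoef F = c by apply: qcoefE => x; apply: cF; exact: slice_real.
split=> //; apply: cvg_real_entire_coef => x; apply/cvg_ex.
by exists (F x%:A); apply: cF; exact: slice_real.
Qed.

Lemma power_term_series_mulr z (c : nat -> H) p N :
  series (power_term z (fun n => c n * p)) N = series (power_term z c) N * p.
Proof.
by rewrite /series/= mulr_suml; apply: eq_bigr => i _; rewrite /power_term mulrA.
Qed.

Lemma power_term_seriesD z (c d : nat -> H) N :
  series (power_term z (fun n => c n + d n)) N =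
  series (power_term z c) N + series (power_term z d) N.
Proof.
by rewrite /series/= -big_split; apply: eq_bigr => i _; rewrite /power_term mulrDr.
Qed.

Lemma qcoef_splits I J f F G : entire I F -> entire I G -> splits I J f F G ->
  qcoef f = fun n => qcoef F n + qcoef G n * J.
Proof.
move=> /entire_qcoef[_ _ cF] /entire_qcoef[_ _ cG] fFG; apply: qcoefE => x.
have hx := @slice_real R I x.
rewrite (fFG _ hx) -/(power_term x%:A _).
rewrite (_ : series _ = fun N => series (power_term x%:A (qcoef F)) N
    + series (power_term x%:A (qcoef G)) N * J); last first.
  by apply/funext => N; rewrite -power_term_series_mulr -power_term_seriesD.
by apply: cvgD; [exact: cF|apply: quat_cvgMr; exact: cG].
Qed.

Lemma entire_coef_splits I J f F G : entire I F -> entire I G ->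
  splits I J f F G -> entire_coef (qcoef f).
Proof.
move=> hF hG fFG; rewrite (qcoef_splits hF hG fFG).
have [_ eF _] := entire_qcoef hF; have [_ eG _] := entire_qcoef hG.
exact: entire_coefD eF (entire_coef_mulr _ eG).
Qed.

(** At real points [sharp F] is the conjugate of [F], and real powers are central and fixed by
    conjugation, which therefore acts on the coefficients alone. *)
Lemma qcoef_sharp I F : entire I F ->
  qcoef (sharp F) = fun n => quat_conj (qcoef F n).
Proof.
move=> /entire_qcoef[_ _ cF]; apply: qcoefE => x.
rewrite /sharp quat_conj_real -/(power_term x%:A _).
rewrite (_ : series _ = fun N => quat_conj (series (power_term x%:A (qcoef F)) N)).
  by apply: cvg_quat_conj; apply: cF; exact: slice_real.
apply/funext => N; rewrite /series/= quat_conj_sum; apply: eq_bigr => n _.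
rewrite /power_term quat_conjM real_quatX quat_conj_real.
by rewrite -scalerAl -scalerAr mul1r mulr1.
Qed.

Lemma entire_coef_conj (c : nat -> H) :
  entire_coef c -> entire_coef (fun n => quat_conj (c n)).
Proof.
move=> hc r r0; have [M cM] := hc r r0; exists M => N.
apply: le_trans (cM N); apply: ler_sum => n _.
by rewrite ler_wpM2l ?exprn_ge0// ler_wpM2l// quat_conj_norm.
Qed.

Lemma entire_coef_sharp I F : entire I F -> entire_coef (qcoef (sharp F)).
Proof.
move=> hF; rewrite (qcoef_sharp hF); apply: entire_coef_conj.
by have [] := entire_qcoef hF.
Qed.

Variables (I J : H) (psi P Q : H -> H).
Hypotheses (hI : imag_unit I) (hJ : imag_unit J) (hIJ : perp I J).
Hypotheses (hP : entire I P) (hQ : entire I Q) (hPQ : splits I J psi P Q).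

Lemma star_slice (g : H -> H) (d : nat -> H) z : entire_coef d ->
  (forall xi, series (power_term xi d) @ \oo --> g xi) -> slice I z ->
  series (power_term z (cauchy_prod (qcoef psi) d)) @ \oo -->
    P z * g z + Q z * J * g (quat_conj z).
Proof.
move=> hd dg hz.
have [sP eP cP] := entire_qcoef hP; have [sQ eQ cQ] := entire_qcoef hQ.
pose PT := power_term z (qcoef P).
pose QT := power_term z (fun n => qcoef Q n * J).
(* With [z ^+ m] written as [z ^+ k * z ^+ (m - k)], the second factor commutes with the
   coefficients of [P] and [Q] but is conjugated on passing [J]: the [Q] part is a Cauchy product
   with the expansion of [g] at [quat_conj z]. *)
rewrite (_ : series _ = fun N => series (cauchy_prod PT (power_term z d)) N
    + series (cauchy_prod QT (power_term (quat_conj z) d)) N); last first.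
  apply/funext => N; rewrite /series/= -big_split; apply: eq_bigr => m _.
  rewrite /= /power_term /cauchy_prod mulr_sumr -big_split; apply: eq_bigr => k _.
  rewrite /= /PT /QT /power_term (qcoef_splits hP hQ hPQ) mulrDl mulrDr.
  have km : (k <= m)%N by rewrite -ltnS.
  have zX j := sliceX j hI hz.
  congr (_ + _).
    rewrite -{1}(subnKC km) exprD -!mulrA; congr (_ * _).
    by rewrite !mulrA (slice_mulC (zX _) (sP k)).
  have Jz j : J * quat_conj z ^+ j = z ^+ j * J.
    rewrite (perp_mul_slice hI hJ hIJ (sliceX j hI (slice_conj hI hz))).
    by rewrite quat_conjX quat_conjK.
  rewrite -{1}(subnKC km) exprD -!mulrA (mulrA J (_ ^+ _)) Jz; congr (_ * _).
  by rewrite !mulrA (slice_mulC (zX _) (sQ k)).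
have [MP hMP] := entire_coef_abs_bounded z eP.
have [MQ hMQ] := entire_coef_abs_bounded z (entire_coef_mulr J eQ).
have [M hM] := entire_coef_abs_bounded z hd.
have [M' hM'] := entire_coef_abs_bounded (quat_conj z) hd.
apply: cvgD; first exact: cvg_cauchy_prod hMP hM (cP z hz) (dg z).
apply: cvg_cauchy_prod hMQ hM' _ (dg _).
rewrite (funext (power_term_series_mulr z (qcoef Q) J)).
by apply: quat_cvgMr; exact: cQ.
Qed.

Lemma starpowS_slice n z : slice I z ->
  starpow psi n.+1 z =
  P z * starpow psi n z + Q z * J * starpow psi n (quat_conj z).
Proof.
move=> hz; have hb := entire_coef_splits hP hQ hPQ.
have h := star_slice (entire_starpow_coef n hb) (fun xi => starpow_expansion hb) hz.
rewrite [LHS]/starpow iterS -/(starpow psi n) /star star_seriesE qcoef_starpow//.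
exact/cvg_lim/h.
Qed.

(** Splitting [starpowS_slice] with [split_mul] gives the first row of [Psi * Psi ^+ n], where [Psi]
    is [splitmx P Q z]; the second row is the same recurrence at [quat_conj z], conjugated. *)
Lemma Phi_starpow n z : slice I z ->
  Phi I J (starpow psi n) z = splitmx P Q z ^+ n.
Proof.
elim: n => [|n IH] hz.
  have h1 w : slice I w -> starpow psi 0 w = 1 + 0 * J by rewrite mul0r addr0.
  have s1 : slice I 1 by rewrite -(scale1r 1); exact: slice_real.
  have s0 : slice I 0 by rewrite -(scale0r 1); exact: slice_real.
  rewrite expr0 (Phi_splits (F := fun=> 1) (G := fun=> 0) hI hJ hIJ)//.
  apply/matrixP => i j; rewrite !mxE /sharp quat_conj1 quat_conj0 oppr0.
  by case: i => -[|[|//]] ?; case: j => -[|[|//]] ?.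
rewrite exprS -IH//.
have [sP _ ] := hP; have [sQ _] := hQ; have hz' := slice_conj hI hz.
have Sp w := quat_splitP (starpow psi n w) hI hJ hIJ.
have step w : slice I w ->
    split_fst I (starpow psi n.+1 w) = P w * split_fst I (starpow psi n w)
      - Q w * quat_conj (split_snd I J (starpow psi n (quat_conj w))) /\
    split_snd I J (starpow psi n.+1 w) = P w * split_snd I J (starpow psi n w)
      + Q w * quat_conj (split_fst I (starpow psi n (quat_conj w))).
  move=> hw; rewrite starpowS_slice//.
  have [a1 b1 e1] := Sp w; have [a2 b2 e2] := Sp (quat_conj w).
  have := split_mul hI hJ hIJ (sP _ hw) (sQ _ hw) a1 b1 a2 b2.
  by rewrite /= -e1 -e2.
have [f1 s1] := step z hz; have [f2 s2] := step _ hz'.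
rewrite quat_conjK in f2 s2.
have [a1 b1 _] := Sp z; have [a2 b2 _] := Sp (quat_conj z).
apply/matrixP => i j; rewrite !mxE big_ord_recl big_ord1 !mxE /sharp /=.
have hPz := slice_conj hI (sP _ hz'); have hQz := slice_conj hI (sQ _ hz').
case: i => -[|[|//]] ?; case: j => -[|[|//]] ? /=.
- by rewrite f1 mulrN.
- by rewrite s1.
(* Conjugation reverses products; commutativity within the slice restores the order required by the
   matrix product. *)
- rewrite [X in quat_conj X]s2.
  move: a1 b2 (slice_conj hI b2).
  move: (split_fst I _) (split_snd I J _) => a b ha hb hb'.
  rewrite quat_conjD !quat_conjM quat_conjK (slice_mulC ha hQz) (slice_mulC hb' hPz).
  by rewrite opprD mulNr mulrN addrC.
- rewrite [X in quat_conj X]f2.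
  move: b1 a2 (slice_conj hI a2).
  move: (split_fst I _) (split_snd I J _) => a b hb ha ha'.
  rewrite quat_conjD quat_conjN !quat_conjM quat_conjK (slice_mulC hb hQz).
  by rewrite (slice_mulC ha' hPz) mulNr addrC.
Qed.

(** The splitting is additive and continuous, hence applies termwise. In [split_mul] the conjugates
    fall on the coefficients of [F] and [G], which produces [sharp F] and [sharp G] next to the
    off-diagonal entry. *)
Lemma split_scomp f F G z : entire I F -> entire I G -> splits I J f F G ->
  slice I z ->
  split_fst I (scomp f psi z) =
    mxfun F (splitmx P Q z) 0 0 - mxfun (sharp G) (splitmx P Q z) 0 1 /\
  split_snd I J (scomp f psi z) =
    mxfun (sharp F) (splitmx P Q z) 0 1 + mxfun G (splitmx P Q z) 0 0.
Proof.
move=> hF hG hFG hz.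
have hb := entire_coef_splits hP hQ hPQ; have ha := entire_coef_splits hF hG hFG.
have [sF eF _] := entire_qcoef hF; have [sG eG _] := entire_qcoef hG.
have eF' := entire_coef_sharp hF; have eG' := entire_coef_sharp hG.
have term n : split_fst I (starpow psi n z * qcoef f n) =
      (splitmx P Q z ^+ n) 0 0 * qcoef F n
      - (splitmx P Q z ^+ n) 0 1 * qcoef (sharp G) n /\
    split_snd I J (starpow psi n z * qcoef f n) =
      (splitmx P Q z ^+ n) 0 1 * qcoef (sharp F) n
      + (splitmx P Q z ^+ n) 0 0 * qcoef G n.
  have -> : qcoef f n = qcoef F n + qcoef G n * J by rewrite (qcoef_splits hF hG hFG).
  have [sa sb e] := quat_splitP (starpow psi n z) hI hJ hIJ.
  rewrite -Phi_starpow// !mxE /= (qcoef_sharp hF) (qcoef_sharp hG) [X in _ /\ _ = X]addrC.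
  have := split_mul hI hJ hIJ sa sb (sF n) (sG n) (sF n) (sG n).
  by rewrite /= -mulrDl -e.
have cS : scomp_series f psi z @ \oo --> scomp f psi z by exact: scomp_series_cvg.
pose M := splitmx P Q z.
have mx phi := mxfun_entry (phi := phi) (A := M).
split.
- rewrite -[LHS](cvg_lim _ (cvg_split_fst (I := I) cS))//; apply/cvg_lim => //.
  rewrite (_ : (fun _ => _) = fun N =>
      series (fun n => (M ^+ n) 0 0 * qcoef F n) N
      - series (fun n => (M ^+ n) 0 1 * qcoef (sharp G) n) N).
    by apply: cvgB; exact: mx.
  apply/funext => N; rewrite /scomp_series /series/= split_fst_sum -sumrB.
  by apply: eq_bigr => n _; rewrite (term n).1.
- rewrite -[LHS](cvg_lim _ (cvg_split_snd (I := I) (J := J) cS))//; apply/cvg_lim => //.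
  rewrite (_ : (fun _ => _) = fun N =>
      series (fun n => (M ^+ n) 0 1 * qcoef (sharp F) n) N
      + series (fun n => (M ^+ n) 0 0 * qcoef G n) N).
    by apply: cvgD; exact: mx.
  apply/funext => N; rewrite /scomp_series /series/= split_snd_sum -big_split.
  by apply: eq_bigr => n _; rewrite (term n).2.
Qed.

End EntireFunctions.

(** Since [limn] also has a value on divergent sequences, the identities are accompanied by
    convergence of the series behind [starpow], [scomp] and [mxfun]. *)
Theorem mainTheorem10 (R : realType) (I J : quat R)
    (f psi F G P Q : quat R -> quat R)
    (hI : imag_unit I) (hJ : imag_unit J) (hIJ : perp I J)
    (hf : slice_regular f) (hpsi : slice_regular psi)
    (hF : entire I F) (hG : entire I G) (hP : entire I P) (hQ : entire I Q)
    (hFG : splits I J f F G) (hPQ : splits I J psi P Q) :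
  let Psi := splitmx P Q in
  let Theta := Phi I J (scomp f psi) in
  [/\ forall n xi, cvgn (star_series psi (starpow psi n) xi),
      forall xi, cvgn (scomp_series f psi xi),
      forall z, slice I z ->
        [/\ cvgn (mxfun_series F (Psi z)),
            cvgn (mxfun_series (sharp F) (Psi z)),
            cvgn (mxfun_series G (Psi z)) &
            cvgn (mxfun_series (sharp G) (Psi z))] &
      forall z, slice I z ->
        [/\ scomp f psi z = Theta z 0 0 + Theta z 0 1 * J,
            Theta z 0 0
              = mxfun F (Psi z) 0 0 - mxfun (sharp G) (Psi z) 0 1 &
            Theta z 0 1
              = mxfun (sharp F) (Psi z) 0 1 + mxfun G (Psi z) 0 0]].
Proof.
move=> Psi Theta.
have hb := entire_coef_splits hP hQ hPQ; have ha := entire_coef_splits hF hG hFG.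
have [_ eF _] := entire_qcoef hF; have [_ eG _] := entire_qcoef hG.
have eF' := entire_coef_sharp hF; have eG' := entire_coef_sharp hG.
split=> [n xi|xi|z _|z hz].
- exact: star_series_starpow_cvg.
- exact: scomp_series_cvg.
- by split; exact: mxfun_series_cvg.
- rewrite !mxE /=; have [_ _ e] := quat_splitP (scomp f psi z) hI hJ hIJ.
  by have [e1 e2] := split_scomp hI hJ hIJ hP hQ hPQ hF hG hFG hz.
Qed.
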